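(* The sequent calculi $\mathbf{G3iM^w}$ and $\mathbf{G4iM}$ are equivalent, i.e., a sequent is derivable in $\mathbf{G3iM^w}$ if and only if it is derivable in $\mathbf{G4iM}$.
   Context: Formulas are built from atoms, $\bot$, $\wedge,\vee,\to$ and $\Box$. Sequents are $\Gamma\Rightarrow\Delta$ with $\Gamma,\Delta$ finite multisets of formulas, $\Delta$ containing at most one formula. $\mathbf{G3iM^w}$ has axioms $\Gamma,p\Rightarrow p$ ($p$ atom), $\Gamma,\bot\Rightarrow\phi$ and rules: $L\wedge$ (from $\Gamma,\phi,\psi\Rightarrow\theta$ infer $\Gamma,\phi\wedge\psi\Rightarrow\theta$), $R\wedge$ (from $\Gamma\Rightarrow\phi$, $\Gamma\Rightarrow\psi$ infer $\Gamma\Rightarrow\phi\wedge\psi$), $L\vee$ (from $\Gamma,\phi\Rightarrow\theta$, $\Gamma,\psi\Rightarrow\theta$ infer $\Gamma,\phi\vee\psi\Rightarrow\theta$), $R\vee$ (from $\Gamma\Rightarrow\phi_i$ infer $\Gamma\Rightarrow\phi_0\vee\phi_1$, $i=0,1$), $L{\to}$ (from $\Gamma,\phi\to\psi\Rightarrow\phi$ and $\Gamma,\psi\Rightarrow\theta$ infer $\Gamma,\phi\to\psi\Rightarrow\theta$), $R{\to}$ (from $\Gamma,\phi\Rightarrow\psi$ infer $\Gamma\Rightarrow\phi\to\psi$), $M^{seq}_\Box$ (from $\phi\Rightarrow\psi$ infer $\Gamma,\Box\phi\Rightarrow\Box\psi$). $\mathbf{G4iM}$ ($\Delta$ a multiset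 with at most one formula) has axioms $\Gamma,p\Rightarrow p$ ($p$ atom) and $\Gamma,\bot\Rightarrow\Delta$, and rules: $L\wedge$ (from $\Gamma,\phi,\psi\Rightarrow\Delta$ infer $\Gamma,\phi\wedge\psi\Rightarrow\Delta$); $R\wedge$; $L\vee$ (from $\Gamma,\phi\Rightarrow\Delta$, $\Gamma,\psi\Rightarrow\Delta$ infer $\Gamma,\phi\vee\psi\Rightarrow\Delta$); $R\vee_i$; $Lp{\to}$ (from $\Gamma,p,\psi\Rightarrow\Delta$ infer $\Gamma,p,p\to\psi\Rightarrow\Delta$, $p$ atom); $L\wedge{\to}$ (from $\Gamma,\phi_1\to(\phi_2\to\psi)\Rightarrow\Delta$ infer $\Gamma,(\phi_1\wedge\phi_2)\to\psi\Rightarrow\Delta$); $L\vee{\to}$ (from $\Gamma,\phi_1\to\psi,\phi_2\to\psi\Rightarrow\Delta$ infer $\Gamma,(\phi_1\vee\phi_2)\to\psi\Rightarrow\Delta$); $R{\to}$; $L{\to}{\to}$ (from $\Gamma,\phi_2\to\psi\Rightarrow\phi_1\to\phi_2$ and $\Gamma,\psi\Rightarrow\Delta$ infer $\Gamma,(\phi_1\to\phi_2)\to\psi\Rightarrow\Delta$); $Lw$ (from $\Gamma\Rightarrow\Delta$ infer $\Gamma,\phi\Rightarrow\Delta$); $Rw$ (from $\Gamma\Rightarrow$ infer $\Gamma\Rightarrow\phi$); $M$ (from $\phi\Rightarrow\psi$ infer $\Box\phi\Rightarrow\Box\psi$); $LM{\to}$ (from $\phi\Rightarrow\psi$ and $\Gamma,\Box\phi,\theta\Rightarrow\Delta$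 infer $\Gamma,\Box\phi,\Box\psi\to\theta\Rightarrow\Delta$).
   Formalization: The rules of G3iM^w as listed derive no sequent with empty succedent, while G4iM derives ''⊥ ⇒ ''; so a sequent Γ ⇒ with empty succedent is read in G3iM^w as Γ ⇒ ⊥. For sequents Γ ⇒ φ the claim is unchanged. *)

(* Defs.v *)
From HB Require Import structures.
From mathcomp Require Import all_boot.
From mathcomp Require Import finmap multiset.

Set Implicit Arguments.
Unset Strict Implicit.
Unset Printing Implicit Defensive.

Inductive form (At : Type) : Type :=
  | Atom of At
  | Bot
  | And of form At & form At
  | Or of form At & form At
  | Imp of form At & form At
  | Box of form At.

Arguments Bot {At}.

(* Multisets of formulas require a choiceType structure on formulas. *)
Section FormChoice.
Variable At : Type.

Fixpoint tree_of_form (f : form At) : GenTree.tree At :=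
  match f with
  | Atom p => GenTree.Leaf p
  | Bot => GenTree.Node 0 [::]
  | And f1 f2 => GenTree.Node 1 [:: tree_of_form f1; tree_of_form f2]
  | Or f1 f2 => GenTree.Node 2 [:: tree_of_form f1; tree_of_form f2]
  | Imp f1 f2 => GenTree.Node 3 [:: tree_of_form f1; tree_of_form f2]
  | Box f1 => GenTree.Node 4 [:: tree_of_form f1]
  end.

Fixpoint form_of_tree (t : GenTree.tree At) : form At :=
  match t with
  | GenTree.Leaf p => Atom p
  | GenTree.Node 1 [:: t1; t2] => And (form_of_tree t1) (form_of_tree t2)
  | GenTree.Node 2 [:: t1; t2] => Or (form_of_tree t1) (form_of_tree t2)
  | GenTree.Node 3 [:: t1; t2] => Imp (form_of_tree t1) (form_of_tree t2)
  | GenTree.Node 4 [:: t1] => Box (form_of_tree t1)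
  | _ => Bot
  end.

Lemma tree_of_formK : cancel tree_of_form form_of_tree.
Proof. by elim=> //= [f1 -> f2 ->|f1 -> f2 ->|f1 -> f2 ->|f1 ->]. Qed.

End FormChoice.

HB.instance Definition _ (At : eqType) :=
  Equality.copy (form At) (can_type (@tree_of_formK At)).
HB.instance Definition _ (At : choiceType) :=
  Choice.copy (form At) (can_type (@tree_of_formK At)).

Declare Scope form_scope.
Delimit Scope form_scope with form.
Bind Scope form_scope with form.
Notation "⊥" := Bot (at level 0) : form_scope.
Notation "□ f" := (Box f) (at level 35, f at level 35, format "□ f") : form_scope.
Notation "f ∧ g" := (And f g) (at level 40, left associativity) : form_scope.
Notation "f ∨ g" := (Or f g) (at level 42, left associativity) : form_scope.
Notation "f ⊃ g" := (Imp f g) (at level 45, right associativity) : form_scope.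

Local Open Scope mset_scope.
Local Open Scope form_scope.

Section Calculi.
Variable At : choiceType.

(* The rules of G3iM^w only involve sequents with exactly one formula in the
   succedent: [G3iMw Γ φ] is derivability of Γ ⇒ φ. *)
Inductive G3iMw : {mset form At} -> form At -> Prop :=
  | G3_ax Γ p : G3iMw (Atom p +` Γ) (Atom p)
  | G3_Lbot Γ φ : G3iMw (⊥ +` Γ) φ
  | G3_Land Γ φ ψ θ :
      G3iMw (φ +` (ψ +` Γ)) θ -> G3iMw ((φ ∧ ψ) +` Γ) θ
  | G3_Rand Γ φ ψ :
      G3iMw Γ φ -> G3iMw Γ ψ -> G3iMw Γ (φ ∧ ψ)
  | G3_Lor Γ φ ψ θ :
      G3iMw (φ +` Γ) θ -> G3iMw (ψ +` Γ) θ -> G3iMw ((φ ∨ ψ) +` Γ) θ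
  | G3_Ror0 Γ φ0 φ1 : G3iMw Γ φ0 -> G3iMw Γ (φ0 ∨ φ1)
  | G3_Ror1 Γ φ0 φ1 : G3iMw Γ φ1 -> G3iMw Γ (φ0 ∨ φ1)
  | G3_Limp Γ φ ψ θ :
      G3iMw ((φ ⊃ ψ) +` Γ) φ -> G3iMw (ψ +` Γ) θ -> G3iMw ((φ ⊃ ψ) +` Γ) θ
  | G3_Rimp Γ φ ψ : G3iMw (φ +` Γ) ψ -> G3iMw Γ (φ ⊃ ψ)
  | G3_M Γ φ ψ : G3iMw [mset φ] ψ -> G3iMw (□φ +` Γ) (□ψ).

(* [G4iM Γ Δ] is derivability of Γ ⇒ Δ, with a succedent of at most one formula
   given by [Δ : option (form At)]. *)
Inductive G4iM : {mset form At} -> option (form At) -> Prop :=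
  | G4_ax Γ p : G4iM (Atom p +` Γ) (Some (Atom p))
  | G4_Lbot Γ Δ : G4iM (⊥ +` Γ) Δ
  | G4_Land Γ φ ψ Δ :
      G4iM (φ +` (ψ +` Γ)) Δ -> G4iM ((φ ∧ ψ) +` Γ) Δ
  | G4_Rand Γ φ ψ :
      G4iM Γ (Some φ) -> G4iM Γ (Some ψ) -> G4iM Γ (Some (φ ∧ ψ))
  | G4_Lor Γ φ ψ Δ :
      G4iM (φ +` Γ) Δ -> G4iM (ψ +` Γ) Δ -> G4iM ((φ ∨ ψ) +` Γ) Δ
  | G4_Ror0 Γ φ0 φ1 : G4iM Γ (Some φ0) -> G4iM Γ (Some (φ0 ∨ φ1))
  | G4_Ror1 Γ φ0 φ1 : G4iM Γ (Some φ1) -> G4iM Γ (Some (φ0 ∨ φ1))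
  | G4_Lpimp Γ p ψ Δ :
      G4iM (Atom p +` (ψ +` Γ)) Δ ->
      G4iM (Atom p +` ((Atom p ⊃ ψ) +` Γ)) Δ
  | G4_Landimp Γ φ1 φ2 ψ Δ :
      G4iM ((φ1 ⊃ (φ2 ⊃ ψ)) +` Γ) Δ -> G4iM (((φ1 ∧ φ2) ⊃ ψ) +` Γ) Δ
  | G4_Lorimp Γ φ1 φ2 ψ Δ :
      G4iM ((φ1 ⊃ ψ) +` ((φ2 ⊃ ψ) +` Γ)) Δ -> G4iM (((φ1 ∨ φ2) ⊃ ψ) +` Γ) Δ
  | G4_Rimp Γ φ ψ : G4iM (φ +` Γ) (Some ψ) -> G4iM Γ (Some (φ ⊃ ψ))
  | G4_Limpimp Γ φ1 φ2 ψ Δ :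
      G4iM ((φ2 ⊃ ψ) +` Γ) (Some (φ1 ⊃ φ2)) -> G4iM (ψ +` Γ) Δ ->
      G4iM (((φ1 ⊃ φ2) ⊃ ψ) +` Γ) Δ
  | G4_Lw Γ φ Δ : G4iM Γ Δ -> G4iM (φ +` Γ) Δ
  | G4_Rw Γ φ : G4iM Γ None -> G4iM Γ (Some φ)
  | G4_M φ ψ : G4iM [mset φ] (Some ψ) -> G4iM [mset □φ] (Some (□ψ))
  | G4_LMimp Γ φ ψ θ Δ :
      G4iM [mset φ] (Some ψ) -> G4iM (□φ +` (θ +` Γ)) Δ ->
      G4iM (□φ +` ((□ψ ⊃ θ) +` Γ)) Δ.

(* G3iM^w has no rule whose conclusion has an empty succedent; as usual for
   single-conclusion calculi, Γ ⇒ is read there as Γ ⇒ ⊥. *)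
Definition G3iMw_derivable (Γ : {mset form At}) (Δ : option (form At)) : Prop :=
  if Δ is Some φ then G3iMw Γ φ else G3iMw Γ ⊥.

End Calculi.

(* Main.v *)
(** Both calculi are compared with a Kleene-style variant [kG3] of G3iM^w whose
    left rules keep their principal formula, so that contexts matter only as
    sets and contraction is built in; cut is admissible in it by Gentzen's
    argument.
    Duplicated formulas are eliminated when passing from [kG3] to G3iM^w by
    allowing the larger context to be merely "covered" by the smaller one, a
    formula being covered when pieces sufficient to replace it are.
    For the passage from [kG3] to G4iM, climb from the root of a [kG3] derivation
    along left premises of L→ until some other rule is met.  This yields either
    a right rule concluding the given sequent or a formula of the context on
    which a left rule of G4iM can act; the premises of that rule follow from the
    sequent by cut, and are smaller in Dyckhoff's ordering. *)

Require Import Defs.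
From mathcomp Require Import all_boot zify.
From mathcomp Require Import finmap multiset.

Local Open Scope mset_scope.

Section Equivalence.
Set Implicit Arguments.
Unset Strict Implicit.
Local Open Scope form_scope.
Variable At : choiceType.
Implicit Types (Γ Σ : {mset form At}) (A B C F φ ψ θ : form At) (p : At).

(** * Weakening and identity in the Kleene-style calculus *)

Inductive kG3 : {mset form At} -> form At -> Prop :=
  | K_ax Γ p : Atom p \in Γ -> kG3 Γ (Atom p)
  | K_Lbot Γ θ : ⊥ \in Γ -> kG3 Γ θ
  | K_Land Γ A B θ : A ∧ B \in Γ -> kG3 (A +` (B +` Γ)) θ -> kG3 Γ θ
  | K_Rand Γ A B : kG3 Γ A -> kG3 Γ B -> kG3 Γ (A ∧ B)
  | K_Lor Γ A B θ :
      A ∨ B \in Γ -> kG3 (A +` Γ) θ -> kG3 (B +` Γ) θ -> kG3 Γ θ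
  | K_Ror0 Γ A B : kG3 Γ A -> kG3 Γ (A ∨ B)
  | K_Ror1 Γ A B : kG3 Γ B -> kG3 Γ (A ∨ B)
  | K_Limp Γ A B θ : A ⊃ B \in Γ -> kG3 Γ A -> kG3 (B +` Γ) θ -> kG3 Γ θ
  | K_Rimp Γ A B : kG3 (A +` Γ) B -> kG3 Γ (A ⊃ B)
  | K_M Γ A B : □A \in Γ -> kG3 [mset A] B -> kG3 Γ (□B).

Ltac msub :=
  let x := fresh "x" in
  let H := fresh "H" in
  move=> x;
  repeat match goal with H : {subset _ <= _} |- _ => move: (H x); clear H end;
  rewrite ?in_mset1D ?in_mset1;
  repeat match goal with
         | |- context [?a == ?b] => case: (a == b)
         | |- context [x \in ?b] => case: (x \in b)
         end;
  done.

(** Rules of [kG3] only test membership in the context, so inclusion of supports is enough and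
    contraction comes for free. *)
Lemma kG3_weak Γ Σ θ : kG3 Γ θ -> {subset Γ <= Σ} -> kG3 Σ θ.
Proof.
move=> d; elim: d Σ => {Γ θ}.
- by move=> Γ p pΓ Σ sub; apply/K_ax/sub.
- by move=> Γ θ bΓ Σ sub; apply/K_Lbot/sub.
- move=> Γ A B θ F_Γ _ IH Σ sub; apply: (@K_Land _ A B); first exact: sub.
  by apply: IH; msub.
- by move=> Γ A B _ IH1 _ IH2 Σ sub; apply: K_Rand; [apply: IH1|apply: IH2].
- move=> Γ A B θ F_Γ _ IH1 _ IH2 Σ sub; apply: (@K_Lor _ A B).
  + exact: sub.
  + by apply: IH1; msub.
  + by apply: IH2; msub.
- by move=> Γ A B _ IH Σ sub; apply/K_Ror0/IH.
- by move=> Γ A B _ IH Σ sub; apply/K_Ror1/IH.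
- move=> Γ A B θ F_Γ _ IH1 _ IH2 Σ sub; apply: (@K_Limp _ A B).
  + exact: sub.
  + exact: IH1.
  + by apply: IH2; msub.
- by move=> Γ A B _ IH Σ sub; apply/K_Rimp/IH; msub.
- by move=> Γ A B F_Γ d _ Σ sub; apply: (K_M _ d); apply: sub.
Qed.

Lemma kG3_weak1 Γ A θ : kG3 Γ θ -> kG3 (A +` Γ) θ.
Proof. by move/kG3_weak; apply; msub. Qed.

Lemma kG3_id A Γ : A \in Γ -> kG3 Γ A.
Proof.
elim: A Γ => [p||A IHA B IHB|A IHA B IHB|A IHA B IHB|A IHA] Γ AΓ.
- exact: K_ax.
- exact: K_Lbot.
- apply: (K_Land AΓ); apply: K_Rand; [apply: IHA|apply: IHB];
    by rewrite !in_mset1D eqxx ?orbT.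
- apply: (K_Lor AΓ); [apply/K_Ror0/IHA|apply/K_Ror1/IHB]; exact: mset1D1.
- apply/K_Rimp/(@K_Limp _ A B); first exact: mset1Dr.
  + exact/IHA/mset1D1.
  + exact/IHB/mset1D1.
- by apply: (K_M AΓ); apply/IHA; rewrite in_mset1.
Qed.

(** * Admissibility of cut *)

Definition right_intro Γ A : Prop :=
  match A with
  | Atom p => Atom p \in Γ
  | Bot => False
  | A ∧ B => kG3 Γ A /\ kG3 Γ B
  | A ∨ B => kG3 Γ A \/ kG3 Γ B
  | A ⊃ B => kG3 (A +` Γ) B
  | □B => exists2 A, □A \in Γ & kG3 [mset A] B
  end.

(* Left rules permute below anything that is inferred from their conclusion. *)
Lemma kG3_left_permute Γ A θ :
  kG3 Γ A ->
  (forall Σ, {subset Γ <= Σ} -> right_intro Σ A -> kG3 Σ θ) -> kG3 Γ θ.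
Proof.
elim=> {Γ A}.
- by move=> Γ p pΓ; apply.
- by move=> Γ A bΓ _; apply: K_Lbot.
- move=> Γ A B C F_Γ _ IH base; apply: (K_Land F_Γ); apply: IH => Σ sub.
  by apply: base; msub.
- by move=> Γ A B dA _ dB _; apply.
- move=> Γ A B C F_Γ _ IH1 _ IH2 base.
  by apply: (K_Lor F_Γ); [apply: IH1|apply: IH2] => Σ sub; apply: base; msub.
- by move=> Γ A B dA _; apply=> //; left.
- by move=> Γ A B dB _; apply=> //; right.
- move=> Γ A B C F_Γ dA _ _ IH2 base; apply: (K_Limp F_Γ dA).
  by apply: IH2 => Σ sub; apply: base; msub.
- by move=> Γ A B dB _; apply.
- by move=> Γ A B AΓ dB _; apply=> //; exists A.
Qed.

Definition cut_admissible A :=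
  forall Γ θ, kG3 Γ A -> kG3 (A +` Γ) θ -> kG3 Γ θ.

Definition immediate_subformula B A : Prop :=
  match A with
  | A1 ∧ A2 | A1 ∨ A2 | A1 ⊃ A2 => B = A1 \/ B = A2
  | □A1 => B = A1
  | _ => False
  end.

(** Inner induction on the derivation that uses [A]: its premises still contain [A], which the inner
    hypothesis removes. If a compound [A] is principal, [kG3_left_permute] brings the derivation of
    [A] to a right introduction, and cuts on immediate subformulas remain. *)
Lemma cut_step A :
  (forall B, immediate_subformula B A -> cut_admissible B) ->
  cut_admissible A.
Proof.
move=> cutI Γ θ dA d.
have: {subset A +` Γ <= A +` Γ} by [].
move: {1 2}(A +` Γ) d => Γ' d; elim: d Γ dA => {Γ' θ}.
- move=> Γ' p pΓ' Γ dA sub; move/sub: pΓ'; rewrite in_mset1D.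
  by case/orP=> [/eqP -> //|]; apply: K_ax.
- move=> Γ' θ bΓ' Γ dA sub; move/sub: bΓ'; rewrite in_mset1D.
  case/orP=> [/eqP E|]; last exact: K_Lbot.
  by apply: (kG3_left_permute dA); rewrite -E.
- move=> Γ' B C θ F_Γ' _ IH Γ dA sub.
  have d: kG3 (B +` (C +` Γ)) θ.
    by apply: IH; [do 2! apply: kG3_weak1 | msub].
  move/sub: F_Γ'; rewrite in_mset1D.
  case/orP=> [/eqP E|F_Γ]; last exact: K_Land F_Γ d.
  have [dB dC] : kG3 Γ B /\ kG3 Γ C.
    (* Permuting with the conjuncts themselves as goals inverts the right rule for conjunction. *)
    by split; apply: (kG3_left_permute dA); rewrite -E => ? _ [].
  rewrite -E /= in cutI.
  apply: (cutI C) => //; first by right.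
  by apply: (cutI B); [left | apply: kG3_weak1 |].
- move=> Γ' B C _ IH1 _ IH2 Γ dA sub.
  by apply: K_Rand; [apply: IH1|apply: IH2].
- move=> Γ' B C θ F_Γ' _ IH1 _ IH2 Γ dA sub.
  have d1: kG3 (B +` Γ) θ by apply: IH1; [apply: kG3_weak1 | msub].
  have d2: kG3 (C +` Γ) θ by apply: IH2; [apply: kG3_weak1 | msub].
  move/sub: F_Γ'; rewrite in_mset1D.
  case/orP=> [/eqP E|F_Γ]; last exact: K_Lor F_Γ d1 d2.
  rewrite -E /= in cutI; apply: (kG3_left_permute dA).
  rewrite -E => Σ subΣ [dB|dC].
  + by apply: (cutI B) => //; [left | apply: (kG3_weak d1); msub].
  + by apply: (cutI C) => //; [right | apply: (kG3_weak d2); msub].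
- by move=> Γ' B C _ IH Γ dA sub; apply/K_Ror0/IH.
- by move=> Γ' B C _ IH Γ dA sub; apply/K_Ror1/IH.
- move=> Γ' B C θ F_Γ' _ IH1 _ IH2 Γ dA sub.
  have d1: kG3 Γ B by apply: IH1.
  have d2: kG3 (C +` Γ) θ by apply: IH2; [apply: kG3_weak1 | msub].
  move/sub: F_Γ'; rewrite in_mset1D.
  case/orP=> [/eqP E|F_Γ]; last exact: K_Limp F_Γ d1 d2.
  rewrite -E /= in cutI; apply: (kG3_left_permute dA).
  rewrite -E => Σ subΣ /= dC.
  apply: (cutI C); first by right.
  + by apply: (cutI B) => //; [left | apply: (kG3_weak d1)].
  + by apply: (kG3_weak d2); msub.
- move=> Γ' B C _ IH Γ dA sub; apply/K_Rimp/IH; last by msub.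
  exact: kG3_weak1.
- move=> Γ' B C F_Γ' d _ Γ dA sub.
  move/sub: F_Γ'; rewrite in_mset1D.
  case/orP=> [/eqP E|F_Γ]; last exact: K_M F_Γ d.
  rewrite -E /= in cutI; apply: (kG3_left_permute dA).
  rewrite -E => Σ subΣ [D DΣ dD]; apply: (K_M DΣ).
  by apply: (cutI B) => //; apply: (kG3_weak d); msub.
Qed.

Lemma kG3_cut A : cut_admissible A.
Proof.
by elim: A => [p||A IHA B IHB|A IHA B IHB|A IHA B IHB|A IHA];
  apply: cut_step => C //=; by [move=> -> | case=> ->].
Qed.

(** * Equivalence of [kG3] and G3iM^w *)

Lemma G3iMw_kG3 Γ θ : G3iMw Γ θ -> kG3 Γ θ.
Proof.
elim=> {Γ θ}.
- by move=> Γ p; apply/K_ax/mset1D1.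
- by move=> Γ θ; apply/K_Lbot/mset1D1.
- move=> Γ A B θ _ IH; apply: (K_Land (mset1D1 _ _)).
  by apply: (kG3_weak IH); msub.
- by move=> Γ A B _ IH1 _ IH2; apply: K_Rand.
- move=> Γ A B θ _ IH1 _ IH2; apply: (K_Lor (mset1D1 _ _)).
  + by apply: (kG3_weak IH1); msub.
  + by apply: (kG3_weak IH2); msub.
- by move=> Γ A B _; apply: K_Ror0.
- by move=> Γ A B _; apply: K_Ror1.
- move=> Γ A B θ _ IH1 _ IH2; apply: (K_Limp (mset1D1 _ _) IH1).
  by apply: (kG3_weak IH2); msub.
- by move=> Γ A B _; apply: K_Rimp.
- by move=> Γ A B _; apply/K_M/mset1D1.
Qed.

(** Each clause for a connective mirrors a premise of its left rule in which the principal formula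
    is dropped: the side formulas of that premise cover it. The left premise of L→ keeps its
    implication, hence no clause through the antecedent. *)
Inductive cov Γ : form At -> Prop :=
  | cov_in F of F \in Γ : cov Γ F
  | cov_and A B of cov Γ A & cov Γ B : cov Γ (A ∧ B)
  | cov_or0 A B of cov Γ A : cov Γ (A ∨ B)
  | cov_or1 A B of cov Γ B : cov Γ (A ∨ B)
  | cov_imp A B of cov Γ B : cov Γ (A ⊃ B).

Lemma cov_trans Γ Σ F :
  (forall A, A \in Γ -> cov Σ A) -> cov Γ F -> cov Σ F.
Proof.
move=> covΓ; elim=> {F}.
- exact: covΓ.
- by move=> A B _ IHA _; apply: cov_and.
- by move=> A B _; apply: cov_or0.
- by move=> A B _; apply: cov_or1.
- by move=> A B _; apply: cov_imp.
Qed.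

Lemma cov_hd A Γ : cov (A +` Γ) A.
Proof. exact/cov_in/mset1D1. Qed.

Lemma cov_replace Γ Σ F A :
  cov Σ F -> {subset Γ <= Σ} -> cov (F +` Γ) A -> cov Σ A.
Proof.
move=> covF sub; apply: cov_trans => B; rewrite in_mset1D.
by case/orP=> [/eqP -> //|/sub]; apply: cov_in.
Qed.

Lemma cov_cons Γ Σ A :
  cov Σ A -> (forall F, F \in Γ -> cov Σ F) ->
  forall F, F \in A +` Γ -> cov Σ F.
Proof. by move=> covA covΓ F; rewrite in_mset1D => /orP[/eqP ->|/covΓ]. Qed.

(** If the principal formula belongs to [Σ], the G3iM^w rule applies, and what it drops is covered
    by its side formulas. If it is covered only by pieces, some premise is already covered by [Σ],
    and the rule is skipped. Atoms, ⊥ and boxes can be covered only by membership. *)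
Lemma kG3_G3iMw_cov Γ Σ θ :
  kG3 Γ θ -> (forall F, F \in Γ -> cov Σ F) -> G3iMw Σ θ.
Proof.
move=> d; elim: d Σ => {Γ θ}.
- move=> Γ p pΓ Σ /(_ _ pΓ) c; inversion_clear c.
  by rewrite -(msetB1K H); apply: G3_ax.
- move=> Γ θ bΓ Σ /(_ _ bΓ) c; inversion_clear c.
  by rewrite -(msetB1K H); apply: G3_Lbot.
- move=> Γ A B θ F_Γ _ IH Σ covΓ; have c := covΓ _ F_Γ.
  inversion_clear c; last by apply: IH; do 2! apply: cov_cons => //.
  rewrite -(msetB1K H) in covΓ *; apply: G3_Land; apply: IH.
  set Δ := _ `\ _ in covΓ *.
  have [cA cB] : cov (A +` (B +` Δ)) A /\ cov (A +` (B +` Δ)) B.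
    by split; apply: cov_in; rewrite !in_mset1D eqxx ?orbT.
  do 2! apply: cov_cons => //; move=> F /covΓ.
  by apply: cov_replace; [apply: cov_and | msub].
- by move=> Γ A B _ IH1 _ IH2 Σ covΓ; apply: G3_Rand; [apply: IH1|apply: IH2].
- move=> Γ A B θ F_Γ _ IH1 _ IH2 Σ covΓ; have c := covΓ _ F_Γ.
  inversion_clear c; [| by apply: IH1; apply: cov_cons
                      | by apply: IH2; apply: cov_cons].
  rewrite -(msetB1K H) in covΓ *; apply: G3_Lor; [apply: IH1|apply: IH2];
    apply: cov_cons (cov_hd _ _) _ => F /covΓ; apply: cov_replace; try by msub.
  + exact/cov_or0/cov_hd.
  + exact/cov_or1/cov_hd.
- by move=> Γ A B _ IH Σ covΓ; apply/G3_Ror0/IH.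
- by move=> Γ A B _ IH Σ covΓ; apply/G3_Ror1/IH.
- move=> Γ A B θ F_Γ _ IH1 _ IH2 Σ covΓ; have c := covΓ _ F_Γ.
  inversion_clear c; last by apply: IH2; apply: cov_cons.
  (* The left premise keeps the implication, so its context is all of [Σ] and the original covering
     serves. *)
  move: (IH1 _ covΓ); rewrite -(msetB1K H) in covΓ *; move=> d1.
  apply: G3_Limp d1 _; apply: IH2; apply: cov_cons (cov_hd _ _) _ => F /covΓ.
  by apply: cov_replace; [exact/cov_imp/cov_hd | msub].
- move=> Γ A B _ IH Σ covΓ; apply/G3_Rimp/IH.
  apply: cov_cons (cov_hd _ _) _ => F /covΓ.
  by apply: cov_trans => C CΣ; apply/cov_in/mset1Dr.
- move=> Γ A B AΓ _ IH Σ /(_ _ AΓ) c; inversion_clear c.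
  rewrite -(msetB1K H); apply/G3_M/IH => F; exact: cov_in.
Qed.

Lemma kG3_G3iMw Γ θ : kG3 Γ θ -> G3iMw Γ θ.
Proof. by move/kG3_G3iMw_cov; apply=> F; apply: cov_in. Qed.

(** * From G4iM to [kG3] *)

Lemma kG3_replace Γ Σ F θ :
  kG3 (F +` Γ) θ -> kG3 Σ F -> {subset Γ <= Σ} -> kG3 Σ θ.
Proof.
move=> d dF sub; apply: (kG3_cut dF).
by apply: (kG3_weak d); msub.
Qed.

Lemma kG3_mp Γ A B : kG3 Γ (A ⊃ B) -> kG3 Γ A -> kG3 Γ B.
Proof.
move=> dAB dA; apply: (kG3_cut dAB); apply: (K_Limp (mset1D1 _ _)).
- exact: kG3_weak1.
- exact/kG3_id/mset1D1.
Qed.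

Ltac kmem := apply: kG3_id; rewrite !in_mset1D !eqxx ?orbT; done.

Lemma G4iM_kG3 Γ Δ : G4iM Γ Δ -> kG3 Γ (odflt ⊥ Δ).
Proof.
elim=> {Γ Δ} /=.
- by move=> Γ p; apply/K_ax/mset1D1.
- by move=> Γ Δ; apply/K_Lbot/mset1D1.
- move=> Γ A B Δ _ IH; apply: (K_Land (mset1D1 _ _)).
  by apply: (kG3_weak IH); msub.
- by move=> Γ A B _ IH1 _ IH2; apply: K_Rand.
- move=> Γ A B Δ _ IH1 _ IH2; apply: (K_Lor (mset1D1 _ _)).
  + by apply: (kG3_weak IH1); msub.
  + by apply: (kG3_weak IH2); msub.
- by move=> Γ A B _; apply: K_Ror0.
- by move=> Γ A B _; apply: K_Ror1.
- move=> Γ p B Δ _; rewrite msetDCA => IH; apply: (kG3_replace IH); last by msub.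
  by apply: (@kG3_mp _ (Atom p)); kmem.
- move=> Γ A B C Δ _ IH; apply: (kG3_replace IH); last by msub.
  do 2! apply: K_Rimp; apply: (@kG3_mp _ (A ∧ B)); first by kmem.
  by apply: K_Rand; kmem.
- move=> Γ A B C Δ _ IH.
  have dC X : kG3 (X +` ((A ∨ B ⊃ C) +` Γ)) (A ∨ B) ->
              kG3 ((A ∨ B ⊃ C) +` Γ) (X ⊃ C).
    by move=> dX; apply: K_Rimp; apply: (@kG3_mp _ (A ∨ B)); first kmem.
  apply: (kG3_cut (A := B ⊃ C)); first by apply: dC; apply: K_Ror1; kmem.
  apply: (kG3_replace IH); last by msub.
  by apply: kG3_weak1; apply: dC; apply: K_Ror0; kmem.
- by move=> Γ A B _; apply: K_Rimp.
- move=> Γ A B C Δ _ IH1 _ IH2; apply: (K_Limp (mset1D1 _ _)).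
  (* Since [B] yields [A ⊃ B], the formula [(A ⊃ B) ⊃ C] yields [B ⊃ C]. *)
  + apply: (kG3_replace IH1); last by msub.
    apply: K_Rimp; apply: (@kG3_mp _ (A ⊃ B)); first by kmem.
    by apply: K_Rimp; kmem.
  + by apply: (kG3_weak IH2); msub.
- by move=> Γ A Δ _; apply: kG3_weak1.
- move=> Γ A _ IH; apply: (kG3_cut IH); exact/K_Lbot/mset1D1.
- by move=> A B _; apply/K_M/mset11.
- move=> Γ A B C Δ _ IH1 _ IH2; apply: (@K_Limp _ (□B) C).
  + exact/mset1Dr/mset1D1.
  + by apply: (K_M _ IH1); apply: mset1D1.
  + by apply: (kG3_weak IH2); msub.
Qed.

(** * From [kG3] to G4iM *)

(** For an implication, the right introduction of its antecedent supplies what Lp→, L→→ and LM→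
    demand. It is impossible for the antecedent ⊥, for which G4iM has no rule. *)
Definition left_step Γ F : Prop :=
  match F with
  | Atom _ | □_ => False
  | Bot | _ ∧ _ | _ ∨ _ => True
  | A ⊃ _ => right_intro Γ A
  end.

(** The left premise of L→ has the same context as its conclusion, so a formula found higher up
    along left premises still lies in [Γ]. *)
Lemma kG3_last_step Γ θ :
  kG3 Γ θ -> right_intro Γ θ \/ exists2 F, F \in Γ & left_step Γ F.
Proof.
elim=> {Γ θ}.
- by left.
- by move=> Γ θ bΓ; right; exists ⊥.
- by move=> Γ A B θ F_Γ _ _; right; exists (A ∧ B).
- by left.
- by move=> Γ A B θ F_Γ _ _ _ _; right; exists (A ∨ B).
- by move=> Γ A B d _; left; left.
- by move=> Γ A B d _; left; right.
- move=> Γ A B θ F_Γ _ [dA|step] _ _; right => //.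
  by exists (A ⊃ B).
- by move=> Γ A B d _; left.
- by move=> Γ A B AΓ d _; left; exists A.
Qed.

(* The exponential 4 ^ w of Dyckhoff's weight w, so that the multiset ordering
   becomes the ordering of sums. *)
Fixpoint fcost A : nat :=
  match A with
  | Atom _ | Bot => 1
  | A ∧ B | A ∨ B => 16 * fcost A * fcost B
  | A ⊃ B => 4 * fcost A * fcost B
  | □A => 4 * fcost A
  end.

Lemma fcost_gt0 A : 0 < fcost A.
Proof. by elim: A => //= *; rewrite ?muln_gt0; lia. Qed.

Definition cost Γ := \sum_(F <- Γ) fcost F.

Lemma cost_cons A Γ : cost (A +` Γ) = fcost A + cost Γ.
Proof.
rewrite /cost -(big_cons _ _ _ _ (fun=> true) fcost); apply: perm_big.
rewrite -{1}(seq_mset_id Γ) -mset_cons; exact: perm_eq_seq_mset.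
Qed.

Lemma cost1 A : cost [mset A] = fcost A.
Proof. by rewrite /cost enum_msetn big_seq1. Qed.

Lemma G4iM_weak Γ Σ Δ : G4iM Γ Δ -> G4iM (Σ `+` Γ) Δ.
Proof.
move=> d; rewrite -(seq_mset_id Σ); elim: (enum_mset Σ) => [|A s IH].
- rewrite (_ : seq_mset _ = mset0) ?mset0D //.
  by apply/msetP => A; rewrite mset_seqE mset0E.
- by rewrite mset_cons -msetDA; apply: G4_Lw.
Qed.

Lemma kG3_G4iM_step Γ Δ :
  (forall Σ Δ', cost Σ + fcost (odflt ⊥ Δ') < cost Γ + fcost (odflt ⊥ Δ) ->
     kG3 Σ (odflt ⊥ Δ') -> G4iM Σ Δ') ->
  kG3 Γ (odflt ⊥ Δ) -> G4iM Γ Δ.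
Proof.
have pos := fcost_gt0.
move=> IH d; case: (kG3_last_step d) => [|[F F_Γ step]].
  case: Δ IH {d} => [[p||A B|A B|A B|B]|] //= IH.
  - by move=> pΓ; rewrite -(msetB1K pΓ); apply: G4_ax.
  - have [pA pB] := (pos A, pos B).
    by case=> dA dB; apply: G4_Rand; apply: IH => //=; nia.
  - have [pA pB] := (pos A, pos B).
    by case=> dI; [apply: G4_Ror0|apply: G4_Ror1]; apply: IH => //=; nia.
  - have [pA pB] := (pos A, pos B).
    by move=> dB; apply/G4_Rimp/IH; rewrite //= cost_cons; nia.
  (* Rule M admits no side formulas, so the rest of the context enters by weakening. *)
  - case=> A AΓ dB; rewrite -(msetB1K AΓ) msetDC; apply/G4iM_weak/G4_M/IH => //.
    rewrite -(msetB1K AΓ) cost1 cost_cons /=.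
    by have [pA pB] := (pos A, pos B); lia.
rewrite -(msetB1K F_Γ) in IH d step *.
move: (Γ `\ F) IH d step => {F_Γ} {}Γ.
case: F => [//||A B|A B|C B|//] IH d step.
- exact: G4_Lbot.
- have [pA pB] := (pos A, pos B).
  apply/G4_Land/IH; first by rewrite !cost_cons /=; nia.
  apply: (kG3_replace d); last by msub.
  by apply: K_Rand; kmem.
- have [pA pB] := (pos A, pos B).
  apply: G4_Lor; apply: IH; rewrite ?cost_cons /=; try nia;
    apply: (kG3_replace d); try msub; [apply: K_Ror0|apply: K_Ror1]; kmem.
(* [B] implies [C ⊃ B], so the implication may be replaced by [B]; this serves the premise with [B]
   in Lp→, L→→ and LM→. *)
have pB := pos B; have dB : kG3 (B +` Γ) (odflt ⊥ Δ).
  by apply: (kG3_replace d); [apply: K_Rimp; apply: kG3_weak1; kmem | msub].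
case: C IH d step dB => [p||C D|C D|C D|D] //= IH d step dB.
- move: step; rewrite in_mset1D /= => /= pΓ.
  rewrite -(msetB1K pΓ) msetDCA; apply: G4_Lpimp.
  rewrite msetDCA msetB1K //; apply: IH => //.
  by rewrite !cost_cons /=; lia.
- have [pC pD] := (pos C, pos D).
  apply: G4_Landimp; apply: IH; first by rewrite !cost_cons /=; nia.
  apply: (kG3_replace d); last by msub.
  apply: K_Rimp; apply: (K_Land (mset1D1 _ _)).
  by apply: (@kG3_mp _ D); [apply: (@kG3_mp _ C)|]; kmem.
- have [pC pD] := (pos C, pos D).
  apply: G4_Lorimp; apply: IH; first by rewrite !cost_cons /=; nia.
  apply: (kG3_replace d); last by msub.
  apply: K_Rimp; apply: (K_Lor (mset1D1 _ _)).
  + by apply: (@kG3_mp _ C); kmem.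
  + by apply: (@kG3_mp _ D); kmem.
- have [pC pD] := (pos C, pos D).
  have [pCD pDB] := (leq_mul pC pD, leq_mul pD pB).
  apply: G4_Limpimp; last by apply: IH => //; rewrite !cost_cons /=; nia.
  (* R→ is applied first because [step] already derives [D] with [C] in the context. *)
  apply: G4_Rimp; apply: IH; first by rewrite !cost_cons /=; nia.
  (* Dyckhoff's observation: in the presence of [C], the formula [D ⊃ B] implies [(C ⊃ D) ⊃ B]. *)
  apply: (@kG3_replace (C +` Γ) _ ((C ⊃ D) ⊃ B)); last by msub.
    by apply: (kG3_weak step); msub.
  apply: K_Rimp; apply: (@kG3_mp _ D); first by kmem.
  by apply: (@kG3_mp _ C); kmem.
- case: step => A; rewrite in_mset1D /= => /= AΓ dD.
  have [pA pD] := (pos A, pos D).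
  move: IH dB; rewrite -(msetB1K AΓ) ![_ +` (□A +` _)]msetDCA => IH dB.
  apply: G4_LMimp; apply: IH => //; rewrite ?cost1 !cost_cons /=; nia.
Qed.

Lemma kG3_G4iM Γ Δ : kG3 Γ (odflt ⊥ Δ) -> G4iM Γ Δ.
Proof.
have [n] := ubnP (cost Γ + fcost (odflt ⊥ Δ)).
elim: n Γ Δ => // n IH Γ Δ le_n; apply: kG3_G4iM_step => Σ Δ' lt.
by apply: IH; lia.
Qed.

End Equivalence.

Theorem theorem3p5 (At : choiceType) (Γ : {mset form At})
    (Δ : option (form At)) :
  G3iMw_derivable Γ Δ <-> G4iM Γ Δ.
Proof.
have -> : G3iMw_derivable Γ Δ = G3iMw Γ (odflt Bot Δ) by case: Δ.
split; first by move/G3iMw_kG3/kG3_G4iM.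
by move/G4iM_kG3/kG3_G3iMw.
Qed.
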